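(* Let $0<\alpha<1$. If $s<0$, then the bilinear estimates $$\|\partial_x(v_1v_2)\|_{X^{s,b-1}(\mathbb{R}^2)}\lesssim\|v_1\|_{X^{s,b}_\alpha(\mathbb{R}^2)}\|v_2\|_{X^{s,b}_\alpha(\mathbb{R}^2)}$$ and $$\|\partial_x(uv)\|_{X^{s,b-1}_\alpha(\mathbb{R}^2)}\lesssim\|u\|_{X^{s,b}(\mathbb{R}^2)}\|v\|_{X^{s,b}_\alpha(\mathbb{R}^2)}$$ both fail for any $b\in\mathbb{R}$.
   Context: $\langle\cdot\rangle=1+|\cdot|$, and for functions of $(x,t)\in\mathbb{R}\times\mathbb{R}$ with space-time Fourier transform $\widehat u(\xi,\tau)$: $\|u\|_{X^{s,b}}=\|\langle\xi\rangle^s\langle\tau-\xi^3\rangle^b\widehat u\|_{L^2_{\xi,\tau}}$ and $\|v\|_{X^{s,b}_\alpha}=\|\langle\xi\rangle^s\langle\tau-\alpha\xi^3\rangle^b\widehat v\|_{L^2_{\xi,\tau}}$. An estimate fails if, for the given $\alpha,s,b$, there is no finite constant for which it holds for all functions in the indicated spaces. *)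

(* Defs.v *)
From mathcomp Require Import all_boot all_order all_algebra.
From mathcomp Require Import complex.
From mathcomp Require Import all_classical all_reals all_analysis.

Set Implicit Arguments.
Unset Strict Implicit.
Unset Printing Implicit Defensive.

Import Order.TTheory GRing.Theory Num.Theory.
Import numFieldNormedType.Exports.

Local Open Scope classical_set_scope.
Local Open Scope ring_scope.
Local Open Scope complex_scope.

Section bourgain_spaces.
Context {R : realType}.
Implicit Types (u v : R * R -> R[i]) (p q : R * R).

Local Notation leb2 := ((@lebesgue_measure R) \x (@lebesgue_measure R))%E.

(* Points of the physical plane are (x, t), of the frequency plane (xi, tau). *)
Definition partial (e : R * R) u : R * R -> R[i] := fun p =>
  'D_e (fun q => complex.Re (u q) : R^o) p +i*
  'D_e (fun q => complex.Im (u q) : R^o) p.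

Definition partial_x u := partial (1, 0) u.
Definition partial_t u := partial (0, 1) u.

(* Since every derivative occurring here is Frechet differentiable, hence
   continuous, u is C^oo and the order of differentiation is irrelevant. *)
Definition schwartz u := forall m n : nat,
  let w := iter m partial_x (iter n partial_t u) in
  [/\ forall p, differentiable (fun q => complex.Re (w q) : R^o) p,
      forall p, differentiable (fun q => complex.Im (w q) : R^o) p &
      forall j k : nat, exists M : R, forall p,
        `|p.1| ^+ j * `|p.2| ^+ k * Normc.normc (w p) <= M].

Definition cintegral u : R[i] :=
  (\int[leb2]_p complex.Re (u p)) +i* (\int[leb2]_p complex.Im (u p)).

Definition expNi (theta : R) : R[i] := cos theta -i* sin theta.

(* \hat u (xi, tau) = \int\int e^{-i (x xi + t tau)} u (x, t) dx dt; the
   unit frequency scale is the one for which d_t + d_x^3 has symbol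
   i (tau - xi^3). *)
Definition fourier u : R * R -> R[i] := fun q =>
  cintegral (fun p => expNi (p.1 * q.1 + p.2 * q.2) * u p).

Definition bracket (a : R) : R := 1 + `|a|.

Definition Xnorm_ (alpha s b : R) u : \bar R :=
  Lnorm leb2 2%:E (fun q =>
    (bracket q.1 `^ s * bracket (q.2 - alpha * q.1 ^+ 3) `^ b
      * Normc.normc (fourier u q))%:E).

Definition Xnorm (s b : R) u : \bar R := Xnorm_ 1 s b u.

(* || d_x (u v) ||_N <= C ||u||_N1 ||v||_N2, stated for Schwartz u and v, where
   the product, d_x and the Fourier transform are classical.  Schwartz functions
   belong to, and are dense in, every X^{s,b}_alpha, so an estimate on those
   spaces restricts to this one, and this one extends to them by continuity. *)
Definition bilinear_estimate (N N1 N2 : (R * R -> R[i]) -> \bar R) :=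
  exists C : R, forall u v, schwartz u -> schwartz v ->
    (N (partial_x (fun p => (u p * v p)%R)) <= C%:E * (N1 u * N2 v))%E.

End bourgain_spaces.

(* Main.v *)
Require Import Defs.
From mathcomp Require Import all_boot all_order all_algebra.
From mathcomp Require Import complex.
From mathcomp Require Import all_classical all_reals all_analysis.
From mathcomp Require Import measurable_realfun ring lra.

Set Implicit Arguments.
Unset Strict Implicit.
Unset Printing Implicit Defensive.

Import Order.TTheory GRing.Theory Num.Theory.
Import numFieldNormedType.Exports.

Local Open Scope classical_set_scope.
Local Open Scope ring_scope.

(** The estimates fail because of resonant interactions at a common large
frequency N.  Suppose that nonzero c1, c2 with c1 + c2 != 0 satisfy

      beta1 * c1 ^ 3 + beta2 * c2 ^ 3 = beta3 * (c1 + c2) ^ 3.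

Take u and v with Fourier transforms concentrated at the points
(cj N, betaj (cj N)^3) of their dispersion curves.  Then u v is concentrated at
the point of frequency (c1 + c2) N of the third curve, so that all three
modulations stay bounded if the packets are narrow enough: width N^-2 in xi,
because the slope of the curves is of order N^2, and width 1 in tau.  The
weights in b are then harmless whatever b is, and comparing the remaining
powers of N, d_x (u v) has norm at least K3 N^(s+2) whereas u and v have norms
at most K1 N^(s+1) and K2 N^(s+1).  An estimate would bound N^(-s)
independently of N, which is impossible for s < 0
(resonant_not_bilinear_estimate).  For 0 < alpha < 1 both curve configurations
are resonant: with c1 = r, c2 = 1 in the first case and c1 = 1, c2 = r in the
second, the condition becomes a quadratic equation in r with positive
discriminant, neither 0 nor -1 being a root.

The packets are modulated Gaussians (gabor), because products, x-derivatives
and Fourier transforms of these are all explicit: gaborM replaces the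
convolution theorem, fourier_gabor and fourier_partial_x_gabor replace the
general theory of the Fourier transform.  The one-dimensional transform of a
Gaussian is obtained from the differential equation F' = - (a / 2k) F that it
satisfies (Rintegral_cos_gaussian), and carried to the plane by Fubini.
Gaussians do not have compact Fourier support, so the upper bounds
(Xnorm_gabor_le) control the polynomially growing weights by half of the
Gaussian exponent, while the lower bound (Xnorm_partial_x_gabor_ge) only looks
at a box around the centre of the packet. *)

(** * One-dimensional Gaussians and their integrals *)

Section gaussian.
Context {R : realType}.
Local Notation mu := (@lebesgue_measure R).

Lemma is_derive_continuous (f f' : R -> R) :
  (forall x : R, is_derive x (1 : R) f (f' x)) -> continuous f.
Proof.
move=> df x; have [dg _] := df x.
exact/differentiable_continuous/derivable1_diffP.
Qed.

Definition gaussian (k x : R) : R := expR (- (k * x ^+ 2)).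

(** The exponent m |x| - k x^2 is largest at |x| = m / 2k. *)
Lemma expR_mul_gaussian_le (m k x : R) : 0 < k ->
  expR (m * `|x|) * gaussian k x <= expR (m ^+ 2 / (4 * k)).
Proof.
move=> k0; rewrite -expRD ler_expR ler_pdivlMr ?mulr_gt0//.
rewrite -(real_normK (num_real x)) -subr_ge0.
by rewrite [leRHS](_ : _ = (2 * k * `|x| - m) ^+ 2) ?sqr_ge0//; ring.
Qed.

Lemma exprn_le_expR (n : nat) (x : R) : `|x| ^+ n <= expR (n%:R * `|x|).
Proof.
rewrite expRM_natl lerXn2r ?nnegrE ?expR_ge0//.
by rewrite (le_trans _ (expR_ge1Dx _))// lerDr.
Qed.

Lemma exprn_gaussian_le (n : nat) (k x : R) : 0 < k ->
  `|x| ^+ n * gaussian k x <= expR (n%:R ^+ 2 / (4 * k)).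
Proof.
move=> k0; apply: le_trans (expR_mul_gaussian_le n%:R x k0).
by rewrite ler_wpM2r ?expR_ge0// exprn_le_expR.
Qed.

Lemma gaussian_ge0 k x : 0 <= gaussian k x.
Proof. exact: expR_ge0. Qed.

Lemma is_derive_gaussian k (x : R) :
  is_derive x 1 (gaussian k) (- (2 * k * x) * gaussian k x).
Proof.
have dk : is_derive x (1 : R) (fun x : R => - (k * x ^+ 2)) (- (2 * k * x)).
  by apply: is_derive_eq; rewrite /GRing.scale/=; ring.
have := @is_derive1_comp R expR (fun x => - (k * x ^+ 2)) x _ _
  (is_derive_expR _) dk.
by rewrite mulrC.
Qed.

Lemma continuous_gaussian k : continuous (gaussian k).
Proof. exact: is_derive_continuous (is_derive_gaussian k). Qed.

Lemma continuous_measurable_EFin (f : R -> R) : continuous f ->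
  measurable_fun [set: measurableTypeR R] (EFin \o f).
Proof.
move=> /continuous_measurable_fun mf; apply/measurable_EFinP; exact: mf.
Qed.

(** Splitting a Gaussian in two lets one half absorb polynomial or exponential
growth while the other one remains integrable. *)
Lemma gaussian_half k x : gaussian k x = gaussian (k / 2) x * gaussian (k / 2) x.
Proof. by rewrite -expRD; congr expR; field. Qed.

Lemma integral_shift_gaussian k m : 0 < k ->
  (\int[mu]_x (gaussian k (x - m))%:E)%E = (Num.sqrt (pi / k))%:E.
Proof.
move=> k0; pose s := Num.sqrt (k * 2)^-1.
have s20 : 0 < (k * 2)^-1 by rewrite invr_gt0 mulr_gt0.
have s0 : s != 0 by rewrite gt_eqF// sqrtr_gt0.
have sE : s ^+ 2 = (k * 2)^-1 by rewrite sqr_sqrtr// ltW.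
have pE : normal_peak s = (Num.sqrt (pi / k))^-1.
  by rewrite /normal_peak sE; congr (Num.sqrt _)^-1; field; rewrite gt_eqF.
have p0 : 0 < Num.sqrt (pi / k) by rewrite sqrtr_gt0 divr_gt0// pi_gt0.
rewrite -[RHS]mule1 -(integral_normal_pdf m s) -ge0_integralZl//.
- apply: eq_integral => x _; rewrite -EFinM normal_pdfE// pE mulVKf ?gt_eqF//.
  by rewrite /normal_fun sE; congr (expR _)%:E; field; rewrite gt_eqF.
- apply/measurable_EFinP; exact: measurable_normal_pdf.
- by move=> x _; rewrite lee_fin normal_pdf_ge0.
Qed.

Lemma integral_gaussian k : 0 < k ->
  (\int[mu]_x (gaussian k x)%:E)%E = (Num.sqrt (pi / k))%:E.
Proof.
move=> k0; rewrite -(integral_shift_gaussian 0 k0).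
by under [RHS]eq_integral do rewrite subr0.
Qed.

Lemma integrable_gaussian k : 0 < k ->
  mu.-integrable setT (EFin \o gaussian k).
Proof.
move=> k0; apply/integrableP; split.
  apply: continuous_measurable_EFin; exact: continuous_gaussian.
under eq_integral do rewrite /= ger0_norm ?gaussian_ge0//.
by rewrite integral_gaussian// ltry.
Qed.

Lemma integrable_dominated_gaussian (f : R -> R) (c k : R) : 0 < k ->
  continuous f -> (forall x, `|f x| <= c * gaussian k x) ->
  mu.-integrable setT (EFin \o f).
Proof.
move=> k0 cf fg.
have ig : mu.-integrable setT (fun x => c%:E * (gaussian k x)%:E)%E.
  by apply: integrableZl => //; exact: integrable_gaussian.
apply: (le_integrable _ _ _ ig) => //.
- exact: continuous_measurable_EFin.
- by move=> x _; rewrite /= lee_fin (le_trans (fg x))// ler_norm.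
Qed.

Lemma continuous_exprn_gaussian (n : nat) k :
  continuous (fun x : R => `|x| ^+ n * gaussian k x).
Proof.
move=> x; apply: cvgM; last exact: continuous_gaussian.
apply: (@continuous_comp _ _ _ (fun x : R => `|x|) (fun x => x ^+ n)).
  exact: norm_continuous.
exact: exprn_continuous.
Qed.

Lemma integrable_exprn_gaussian (n : nat) k : 0 < k ->
  mu.-integrable setT (EFin \o (fun x => `|x| ^+ n * gaussian k x)).
Proof.
move=> k0.
have k20 : 0 < k / 2 by rewrite divr_gt0.
apply: (@integrable_dominated_gaussian _ (expR (n%:R ^+ 2 / (4 * (k / 2)))) _ k20).
  exact: continuous_exprn_gaussian.
move=> x; rewrite ger0_norm ?mulr_ge0 ?exprn_ge0 ?gaussian_ge0//.
rewrite (gaussian_half k x) [leLHS]mulrA ler_wpM2r ?gaussian_ge0//.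
exact: exprn_gaussian_le.
Qed.

(** The fundamental theorem of calculus on [-n, n], with n going to infinity:
this is the form in which integration by parts on the line is used below. *)
Lemma Rintegral_derive0 (h h' : R -> R) (C : R) :
  (forall x : R, is_derive x 1 h (h' x)) -> continuous h' ->
  mu.-integrable setT (EFin \o h') ->
  (forall x, `|x| * `|h x| <= C) ->
  \int[mu]_x h' x = 0.
Proof.
move=> hd ch ih hC.
pose f_ (n : nat) := (EFin \o h') \_ `[- n.+1%:R, n.+1%:R].
have mh : measurable_fun [set: measurableTypeR R] (EFin \o h').
  exact: measurable_int ih.
have mf n : measurable_fun [set: measurableTypeR R] (f_ n).
  apply/(measurable_restrictT _ _).1 => //; exact: measurable_funS mh.
have cf : \forall x \ae mu, setT x -> f_ n x @[n --> \oo] --> (EFin \o h') x.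
  apply: aeW => x _; apply: cvg_near_cst.
  near=> n; rewrite /f_ patchE ifT// inE/= in_itv/= -ler_norml.
  rewrite (@le_trans _ _ n%:R) ?ler_nat//.
  near: n; exact: nbhs_infty_ger.
have df : \forall x \ae mu, forall n : nat, setT x ->
    (`|f_ n x| <= (abse \o (EFin \o h')) x)%E.
  apply: aeW => x n _; rewrite /f_ patchE; case: ifPn => //= _.
  by rewrite normr0 lee_fin.
have [_ _] := @dominated_convergence _ (measurableTypeR R) R mu setT
  measurableT f_ _ _ mf mh cf (integrable_abse ih) df.
have fE n : (\int[mu]_x f_ n x)%E = (h n.+1%:R - h (- n.+1%:R))%:E.
  rewrite /f_ -integral_mkcond (continuous_FTC2 (F := h))//.
  - by rewrite -subr_gt0 opprK ltr_wpDl.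
  - exact: continuous_subspaceT.
  - have ch0 := is_derive_continuous hd.
    split.
    + by move=> x _; have [] := hd x.
    + exact/cvg_at_right_filter/ch0.
    + exact/cvg_at_left_filter/ch0.
  - by move=> x _; rewrite derive1E; have [] := hd x.
(* the decay of h gives |h (+-(n + 1))| <= C / (n + 1) *)
have h0 : h n.+1%:R - h (- n.+1%:R) @[n --> \oo] --> (0 : R).
  apply: norm_cvg0; apply: (@squeeze_cvgr _ _ _ _ (cst 0)
    (fun n => 2 * C * harmonic n)).
  - apply: nearW => n; rewrite normr_ge0/= /harmonic.
    rewrite ler_pdivlMr// (le_trans (ler_wpM2r _ (ler_normB _ _)))//.
    have := hC n.+1%:R; have := hC (- n.+1%:R); rewrite normrN ger0_norm//.
    by rewrite mulrDl ![_ * n.+1%:R]mulrC; lra.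
  - exact: cvg_cst.
  - rewrite -[X in _ --> X](mulr0 (2 * C)); apply: cvgM; first exact: cvg_cst.
    exact: cvg_harmonic.
rewrite /Rintegral => /cvg_lim <-//; rewrite (_ : limn _ = 0%E)//.
apply/cvg_lim => //; under eq_fun do rewrite fE.
by apply: cvg_EFin; [exact: nearW|exact: h0].
Unshelve. all: end_near. Qed.

End gaussian.

(** * The Fourier transform of a Gaussian *)

Section fourier_gaussian.
Context {R : realType}.
Local Notation mu := (@lebesgue_measure R).

Lemma is_derive_cos_affine (a c x : R) :
  is_derive x (1 : R) (fun x => cos (a * x + c)) (- a * sin (a * x + c)).
Proof.
have dk : is_derive x (1 : R) (fun x : R => a * x + c) a.
  by apply: is_derive_eq; rewrite /GRing.scale/=; ring.
have := @is_derive1_comp R cos (fun x => a * x + c) x _ _ (is_derive_cos _) dk.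
by rewrite mulrC mulrN -mulNr.
Qed.

Lemma is_derive_sin_affine (a c x : R) :
  is_derive x (1 : R) (fun x => sin (a * x + c)) (a * cos (a * x + c)).
Proof.
have dk : is_derive x (1 : R) (fun x : R => a * x + c) a.
  by apply: is_derive_eq; rewrite /GRing.scale/=; ring.
have := @is_derive1_comp R sin (fun x => a * x + c) x _ _ (is_derive_sin _) dk.
by rewrite mulrC.
Qed.

Lemma continuous_cos_gaussian n a c k :
  continuous (fun x : R => x ^+ n * (cos (a * x + c) * gaussian k x)).
Proof.
move=> x; apply: cvgM; first exact: exprn_continuous.
apply: cvgM; last exact: continuous_gaussian.
exact: is_derive_continuous (is_derive_cos_affine a c) x.
Qed.

Lemma integrable_cos_gaussian n a c k : 0 < k ->
  mu.-integrable setT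
    (EFin \o (fun x => x ^+ n * (cos (a * x + c) * gaussian k x))).
Proof.
move=> k0; apply: (le_integrable _ _ _ (integrable_exprn_gaussian n k0)) => //.
  by apply: continuous_measurable_EFin; exact: continuous_cos_gaussian.
move=> x _; rewrite /= lee_fin !normrM !normrX normr_id ler_wpM2l ?exprn_ge0//.
by rewrite ler_piMl// cos_max.
Qed.

Lemma integrable_sin_gaussian n a c k : 0 < k ->
  mu.-integrable setT
    (EFin \o (fun x => x ^+ n * (sin (a * x + c) * gaussian k x))).
Proof.
move=> /(integrable_cos_gaussian n a (c - pi / 2)).
by under eq_fun do rewrite addrA cosBpihalf.
Qed.

(** Integration by parts: the derivative of sin (a x + c) * gaussian k x has zero
integral. *)
Lemma Rintegral_mul_sin_gaussian a c k : 0 < k ->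
  \int[mu]_x (x * (sin (a * x + c) * gaussian k x)) =
  a / (2 * k) * \int[mu]_x (cos (a * x + c) * gaussian k x).
Proof.
move=> k0.
have i1 := integrable_sin_gaussian 1 a c k0.
have i0 : mu.-integrable setT
    (EFin \o (fun x => cos (a * x + c) * gaussian k x)).
  by have := integrable_cos_gaussian 0 a c k0; under eq_fun do rewrite mul1r.
pose h x := sin (a * x + c) * gaussian k x.
pose h' x := a * (cos (a * x + c) * gaussian k x)
             - 2 * k * (x ^+ 1 * (sin (a * x + c) * gaussian k x)).
have ih1 : mu.-integrable setT
    (EFin \o (fun x => a * (cos (a * x + c) * gaussian k x))).
  by apply: (integrableZl _ a i0).
have ih2 : mu.-integrable setT
    (EFin \o (fun x => 2 * k * (x ^+ 1 * (sin (a * x + c) * gaussian k x)))).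
  by apply: (integrableZl _ (2 * k) i1).
have : \int[mu]_x h' x = 0.
  apply: (@Rintegral_derive0 _ h h' (expR (1 ^+ 2 / (4 * k)))).
  - move=> x; rewrite /h.
    have := @is_deriveM _ _ _ _ x _ _ _ (is_derive_sin_affine a c x)
      (is_derive_gaussian k x).
    by move=> /is_derive_eq; apply; rewrite /h' /GRing.scale/= expr1; ring.
  - move=> x; apply: (@cvgB _ R^o); apply: cvgM; try exact: cvg_cst.
      have := @continuous_cos_gaussian 0 a c k x.
      by rewrite /continuous_at; under eq_fun do rewrite mul1r; rewrite mul1r.
    have := @continuous_cos_gaussian 1 a (c - pi / 2) k x.
    rewrite /continuous_at; under eq_fun do rewrite addrA cosBpihalf.
    by rewrite addrA cosBpihalf.
  - have := integrableB measurableT ih1 ih2.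
    by apply: eq_integrable => // x _; rewrite /= EFinB.
  - move=> x; have := exprn_gaussian_le 1 x k0; apply: le_trans.
    rewrite expr1 ler_wpM2l// normrM (ger0_norm (gaussian_ge0 _ _)).
    by rewrite ler_piMl ?gaussian_ge0// sin_max.
rewrite RintegralB// !RintegralZl// => /eqP; rewrite subr_eq0 => /eqP E.
rewrite mulrAC E; under [in RHS]eq_Rintegral do rewrite expr1.
by field; rewrite gt_eqF.
Qed.

(** Differentiating under the integral sign brings out - x sin (a x + c), which
the previous lemma turns back into the original integrand. *)
Lemma is_derive_Rintegral_cos_gaussian c k (a : R) : 0 < k ->
  is_derive a (1 : R) (fun a => \int[mu]_x (cos (a * x + c) * gaussian k x))
    (- (a / (2 * k) * \int[mu]_x (cos (a * x + c) * gaussian k x))).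
Proof.
move=> k0; rewrite -Rintegral_mul_sin_gaussian//.
pose f (a x : R) := cos (a * x + c) * gaussian k x.
have df (b x : R) : is_derive b (1 : R) (f ^~ x)
    (- x * (sin (b * x + c) * gaussian k x)).
  have -> : f ^~ x = (fun b => cos (x * b + c)) * cst (gaussian k x).
    by apply/funext => y; rewrite /f (mulrC y).
  have := @is_deriveM _ _ _ _ b _ _ _ (is_derive_cos_affine x c b)
    (is_derive_cst (gaussian k x) b (1 : R)).
  by move=> /is_derive_eq; apply; rewrite /GRing.scale/= (mulrC b); ring.
(* any neighbourhood of a will do, the domination being uniform in a *)
have Ia : `]a - 1, a + 1[%classic a by rewrite /= in_itv/=; lra.
have if_ b : `]a - 1, a + 1[%classic b -> mu.-integrable setT (EFin \o f b).
  move=> _; have := integrable_cos_gaussian 0 b c k0.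
  by under eq_fun do rewrite mul1r.
have der b x : `]a - 1, a + 1[%classic b -> [set: R] x -> derivable (f ^~ x) b 1.
  by move=> _ _; have [] := df b x.
have G0 x : 0 <= `|x| ^+ 1 * gaussian k x.
  by rewrite mulr_ge0 ?gaussian_ge0// exprn_ge0.
have dfE b x : partial1of2 f b x = - x * (sin (b * x + c) * gaussian k x).
  by rewrite partial1of2E; have [] := df b x.
have ub b x : `]a - 1, a + 1[%classic b -> [set: R] x ->
    `|partial1of2 f b x| <= `|x| ^+ 1 * gaussian k x.
  move=> _ _; rewrite dfE !normrM normrN expr1 ler_wpM2l//.
  rewrite (ger0_norm (gaussian_ge0 _ _)).
  by rewrite ler_piMl ?gaussian_ge0// sin_max.
have iG := integrable_exprn_gaussian 1 k0.
apply: DeriveDef; first exact: (derivable_under_integral measurableT Ia if_ der G0 iG ub).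
rewrite -derive1E.
rewrite (differentiation_under_integral measurableT Ia if_ der G0 iG ub).
under eq_Rintegral do rewrite dfE mulNr -mulN1r.
rewrite RintegralZl ?mulN1r//.
by have := integrable_sin_gaussian 1 a c k0; under eq_fun do rewrite expr1.
Qed.

(** The differential equation just found makes the product of the integral with
exp (a^2 / 4k) constant in a; its value at a = 0 is the Gaussian integral.
Keeping an arbitrary phase c treats the real and imaginary parts of the Fourier
transform at once, and lets the variable t enter as a phase when the double
integrals below are computed by slices. *)
Lemma Rintegral_cos_gaussian a c k : 0 < k ->
  \int[mu]_x (cos (a * x + c) * gaussian k x) =
  cos c * (Num.sqrt (pi / k) * gaussian (4 * k)^-1 a).
Proof.
move=> k0; pose F a := \int[mu]_x (cos (a * x + c) * gaussian k x).
(* gaussian l grows: it is exp (a^2 / 4k), the inverse of the claimed value *)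
pose l := - (4 * k)^-1.
have E : F a * gaussian l a = F 0 * gaussian l 0.
  apply: (@is_derive_0_is_cst _ (fun a => F a * gaussian l a)) => x.
  have := @is_deriveM _ _ _ _ x _ _ _ (is_derive_Rintegral_cos_gaussian c x k0)
      (is_derive_gaussian l x).
  by move=> /is_derive_eq; apply; rewrite /F /GRing.scale/= /l; field; rewrite gt_eqF.
have F0 : F 0 = cos c * Num.sqrt (pi / k).
  rewrite /F; under eq_Rintegral do rewrite mul0r add0r.
  rewrite RintegralZl//; last exact: integrable_gaussian.
  by rewrite /Rintegral integral_gaussian.
have gl : gaussian l a * gaussian (4 * k)^-1 a = 1.
  by rewrite -expRD -[RHS]expR0 /l mulNr opprK subrr.
have g0 : gaussian l 0 = 1 by rewrite /gaussian expr0n mulr0 oppr0 expR0.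
have := congr1 ( *%R^~ (gaussian (4 * k)^-1 a)) E.
by rewrite /= -mulrA gl mulr1 g0 mulr1 F0 -mulrA.
Qed.

End fourier_gaussian.

(** * Oscillating Gaussian integrals in the plane *)

Section fourier_gabor.
Context {R : realType}.
Local Notation mu := (@lebesgue_measure R).
Local Notation leb2 := (mu \x mu)%E.
Local Notation R2 := (measurableTypeR R * measurableTypeR R)%type.

(** The Fourier transform of gaussian k at the frequency a. *)
Definition gaussian_hat (k a : R) : R :=
  Num.sqrt (pi / k) * gaussian (4 * k)^-1 a.

Lemma measurable_continuous_fst (f : R -> R) : continuous f ->
  measurable_fun [set: R2] (fun p => f p.1).
Proof.
by move=> /continuous_measurable_fun mf; exact: (measurableT_comp mf measurable_fst).
Qed.

Lemma measurable_continuous_snd (f : R -> R) : continuous f ->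
  measurable_fun [set: R2] (fun p => f p.2).
Proof.
by move=> /continuous_measurable_fun mf; exact: (measurableT_comp mf measurable_snd).
Qed.

Lemma integrable_tensor (f g : R -> R) : continuous f -> continuous g ->
  mu.-integrable setT (EFin \o f) -> mu.-integrable setT (EFin \o g) ->
  leb2.-integrable setT (EFin \o (fun p : R2 => f p.1 * g p.2)).
Proof.
move=> cf cg /integrableP[mf intf] /integrableP[mg intg].
apply/integrable12ltyP.
  apply/measurable_EFinP; apply: measurable_funM.
    exact: measurable_continuous_fst.
  exact: measurable_continuous_snd.
have mabs (h : R -> R) : measurable_fun [set: measurableTypeR R] (EFin \o h) ->
    measurable_fun [set: measurableTypeR R] (fun x => `|h x|%:E).
  by move=> mh; exact: (measurableT_comp (@abse_measurable R setT) mh).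
pose C := (\int[mu]_y `|g y|%:E)%E.
have C0 : (0 <= C)%E by exact: integral_ge0.
have E x : (\int[mu]_y `|(f x * g y)%:E| = `|f x|%:E * C)%E.
  rewrite -ge0_integralZl//; last exact: mabs.
  by apply: eq_integral => y _; rewrite /= normrM EFinM.
under eq_integral do rewrite /= E.
rewrite ge0_integralZr//; last exact: mabs.
by rewrite lte_mul_pinfty// ?integral_ge0// ge0_fin_numE// integral_ge0.
Qed.

Lemma measurable_cos_affine2 (a b c : R) :
  measurable_fun [set: R2] (fun p : R2 => cos (a * p.1 + b * p.2 + c)).
Proof.
have mc := continuous_measurable_fun (@continuous_cos R).
apply: (measurableT_comp mc); apply: measurable_funD => //.
by apply: measurable_funD; apply: measurable_funM => //; exact: measurable_fst.
Qed.

Lemma integrable_cos_gaussian2 n a b c k l : 0 < k -> 0 < l ->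
  leb2.-integrable setT (EFin \o (fun p : R2 => p.1 ^+ n *
    (cos (a * p.1 + b * p.2 + c) * (gaussian k p.1 * gaussian l p.2)))).
Proof.
move=> k0 l0.
have := integrable_tensor _ _ (integrable_exprn_gaussian n k0)
  (integrable_gaussian l0).
move=> /(_ (@continuous_exprn_gaussian _ n k) (@continuous_gaussian _ l)) ig.
apply: (le_integrable _ _ _ ig) => //.
  apply/measurable_EFinP; apply: measurable_funM.
    exact: (measurable_continuous_fst (@exprn_continuous R n)).
  apply: measurable_funM; first exact: measurable_cos_affine2.
  apply: measurable_funM.
    exact: (measurable_continuous_fst (@continuous_gaussian R k)).
  exact: (measurable_continuous_snd (@continuous_gaussian R l)).
move=> p _; rewrite /= lee_fin !normrM !normrX normr_id -mulrA ler_wpM2l ?exprn_ge0//.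
by rewrite ler_piMl ?mulr_ge0// cos_max.
Qed.

Lemma integrable_sin_gaussian2 n a b c k l : 0 < k -> 0 < l ->
  leb2.-integrable setT (EFin \o (fun p : R2 => p.1 ^+ n *
    (sin (a * p.1 + b * p.2 + c) * (gaussian k p.1 * gaussian l p.2)))).
Proof.
move=> k0 l0; have := integrable_cos_gaussian2 n a b (c - pi / 2) k0 l0.
by under eq_fun do rewrite addrA cosBpihalf.
Qed.

Lemma Rintegral_iterated (f : R2 -> R) :
  leb2.-integrable setT (EFin \o f) ->
  (forall x, mu.-integrable setT (EFin \o (fun y => f (x, y)))) ->
  \int[leb2]_p f p = \int[mu]_x \int[mu]_y f (x, y).
Proof.
move=> if2 if1; rewrite {1}/Rintegral -integral12_prod_meas1//.
congr fine; apply: eq_integral => x _.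
rewrite /fubini_F/= /Rintegral fineK//.
exact: (integrable_fin_num _ (if1 x)).
Qed.

(** For fixed x, the term a x + c is a phase in the integral over t. *)
Lemma Rintegral_cos_gaussian2 n a b c k l : 0 < k -> 0 < l ->
  \int[leb2]_p (p.1 ^+ n *
    (cos (a * p.1 + b * p.2 + c) * (gaussian k p.1 * gaussian l p.2))) =
  gaussian_hat l b *
  \int[mu]_x (x ^+ n * (cos (a * x + c) * gaussian k x)).
Proof.
move=> k0 l0; rewrite Rintegral_iterated/=; first last.
- move=> x; have := integrable_cos_gaussian 0 b (a * x + c) l0.
  move=> /(integrableZl measurableT (x ^+ n * gaussian k x)).
  apply: eq_integrable => // y _; rewrite /= -EFinM expr0 mul1r addrCA addrA.
  by congr EFin; ring.
- exact: integrable_cos_gaussian2.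
rewrite -RintegralZl//; last exact: integrable_cos_gaussian.
apply: eq_Rintegral => x _.
transitivity (\int[mu]_y (x ^+ n * gaussian k x *
    (cos (b * y + (a * x + c)) * gaussian l y))).
  by apply: eq_Rintegral => y _; rewrite [in RHS]addrCA addrA; ring.
rewrite RintegralZl//; last first.
  have := integrable_cos_gaussian 0 b (a * x + c) l0.
  by under eq_fun do rewrite mul1r.
by rewrite Rintegral_cos_gaussian// -/(gaussian_hat l b); ring.
Qed.

Lemma Rintegral_cos_gabor a b c k l : 0 < k -> 0 < l ->
  \int[leb2]_p
    (cos (a * p.1 + b * p.2 + c) * (gaussian k p.1 * gaussian l p.2)) =
  cos c * (gaussian_hat k a * gaussian_hat l b).
Proof.
move=> k0 l0; have := Rintegral_cos_gaussian2 0 a b c k0 l0.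
under eq_Rintegral do rewrite mul1r.
under [in RHS]eq_Rintegral do rewrite mul1r.
by move=> ->; rewrite Rintegral_cos_gaussian// -/(gaussian_hat k a); ring.
Qed.

Lemma Rintegral_sin_gabor a b c k l : 0 < k -> 0 < l ->
  \int[leb2]_p
    (sin (a * p.1 + b * p.2 + c) * (gaussian k p.1 * gaussian l p.2)) =
  sin c * (gaussian_hat k a * gaussian_hat l b).
Proof.
move=> k0 l0; rewrite -cosBpihalf -Rintegral_cos_gabor//.
by apply: eq_Rintegral => p _; rewrite addrA cosBpihalf.
Qed.

Lemma Rintegral_mul_sin_gabor a b c k l : 0 < k -> 0 < l ->
  \int[leb2]_p (p.1 *
    (sin (a * p.1 + b * p.2 + c) * (gaussian k p.1 * gaussian l p.2))) =
  a / (2 * k) * (cos c * (gaussian_hat k a * gaussian_hat l b)).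
Proof.
move=> k0 l0; have := Rintegral_cos_gaussian2 1 a b (c - pi / 2) k0 l0.
under eq_Rintegral do rewrite addrA cosBpihalf expr1.
under [in RHS]eq_Rintegral do rewrite addrA cosBpihalf expr1.
move=> ->; rewrite Rintegral_mul_sin_gaussian// Rintegral_cos_gaussian//.
by rewrite -/(gaussian_hat k a); ring.
Qed.

Lemma Rintegral_mul_cos_gabor a b c k l : 0 < k -> 0 < l ->
  \int[leb2]_p (p.1 *
    (cos (a * p.1 + b * p.2 + c) * (gaussian k p.1 * gaussian l p.2))) =
  - (a / (2 * k) * (sin c * (gaussian_hat k a * gaussian_hat l b))).
Proof.
move=> k0 l0.
transitivity (\int[leb2]_p (p.1 * (sin (a * p.1 + b * p.2 + (c + pi / 2)) *
    (gaussian k p.1 * gaussian l p.2)))).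
  by apply: eq_Rintegral => p _; rewrite addrA sinDpihalf.
by rewrite Rintegral_mul_sin_gabor// cosDpihalf; ring.
Qed.

End fourier_gabor.

(** * Directional derivatives in the plane *)

Section derivatives.
Context {R : realType}.

Lemma differentiable_comp_fst (f f' : R -> R) :
  (forall x : R, is_derive x (1 : R) f (f' x)) ->
  forall p : R * R, differentiable (fun q : R * R => f q.1 : R^o) p.
Proof.
move=> df p; apply: (@differentiable_comp _ _ _ _ (fst : R * R -> R) f).
  by apply: (@linear_differentiable _ _ _ fst); move=> q; exact: cvg_fst.
by apply/derivable1_diffP; have [] := df p.1.
Qed.

Lemma differentiable_comp_snd (f f' : R -> R) :
  (forall x : R, is_derive x (1 : R) f (f' x)) ->
  forall p : R * R, differentiable (fun q : R * R => f q.2 : R^o) p.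
Proof.
move=> df p; apply: (@differentiable_comp _ _ _ _ (snd : R * R -> R) f).
  by apply: (@linear_differentiable _ _ _ snd); move=> q; exact: cvg_snd.
by apply/derivable1_diffP; have [] := df p.2.
Qed.

Lemma derive_fst (f : R * R -> R) (p : R * R) :
  'D_(1, 0) (f : R * R -> R^o) p = 'D_(1 : R) (fun x => f (x, p.2) : R) p.1.
Proof.
apply: (congr1 (fun F : R -> R^o => lim (F @ 0^'))); apply/funext => h /=.
congr (_ *: (f _ - f _)); last by case: p.
by apply/pair_equal_spec; split => //=; rewrite scaler0 add0r.
Qed.

Lemma derive_snd (f : R * R -> R) (p : R * R) :
  'D_(0, 1) (f : R * R -> R^o) p = 'D_(1 : R) (fun y => f (p.1, y) : R) p.2.
Proof.
apply: (congr1 (fun F : R -> R^o => lim (F @ 0^'))); apply/funext => h /=.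
congr (_ *: (f _ - f _)); last by case: p.
by apply/pair_equal_spec; split => //=; rewrite scaler0 add0r.
Qed.

End derivatives.

(** * A space of Schwartz functions closed under differentiation *)

Section wave_span.
Context {R : realType}.

Lemma is_derive_exprn (n : nat) (x : R) :
  is_derive x (1 : R) (fun x : R => x ^+ n) (n%:R * x ^+ n.-1).
Proof.
apply: DeriveDef; first exact: exprn_derivable.
by rewrite exp_derive /GRing.scale/= mulr1.
Qed.

Lemma differentiable_mulf (f g : R * R -> R) p :
  differentiable (f : _ -> R^o) p -> differentiable (g : _ -> R^o) p ->
  differentiable (fun q => f q * g q : R^o) p.
Proof. exact: differentiableM. Qed.

Lemma is_derive_mull (a x : R) : is_derive x (1 : R) (fun x : R => a * x) a.
Proof. by apply: is_derive_eq; rewrite /GRing.scale/=; ring. Qed.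

Definition wave1 (k a : R) (j : nat) (c x : R) : R :=
  x ^+ j * (cos (a * x + c) * gaussian k x).

Lemma is_derive_wave1 k a j c r (x : R) :
  is_derive x (1 : R) (fun x => r * wave1 k a j c x)
    (r * (j%:R * wave1 k a j.-1 c x
          + (a * wave1 k a j (c + pi / 2) x - 2 * k * wave1 k a j.+1 c x))).
Proof.
have := is_deriveZ r (is_deriveM (is_derive_exprn j x)
  (is_deriveM (is_derive_cos_affine a c x) (is_derive_gaussian k x))).
move=> /is_derive_eq; apply; rewrite mulrfctE /GRing.scale/= /wave1 (addrA (a * x)).
rewrite cosDpihalf exprS.
ring.
Qed.

Variables (k l a b : R).

Definition wave (j m : nat) (c : R) (p : R * R) : R :=
  p.1 ^+ j * p.2 ^+ m *
  (cos (a * p.1 + b * p.2 + c) * (gaussian k p.1 * gaussian l p.2)).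

Lemma waveE_fst j m c x y :
  wave j m c (x, y) = y ^+ m * gaussian l y * wave1 k a j (b * y + c) x.
Proof. by rewrite /wave /wave1 /= addrA; ring. Qed.

Lemma waveE_snd j m c x y :
  wave j m c (x, y) = x ^+ j * gaussian k x * wave1 l b m (a * x + c) y.
Proof. by rewrite /wave /wave1 /= addrCA addrA; ring. Qed.

Lemma differentiable_wave j m c (p : R * R) :
  differentiable (wave j m c : _ -> R^o) p.
Proof.
apply: (@differentiable_mulf (fun p => p.1 ^+ j * p.2 ^+ m)
  (fun p => cos (a * p.1 + b * p.2 + c) * (gaussian k p.1 * gaussian l p.2))).
  apply: (@differentiable_mulf (fun p => p.1 ^+ j) (fun p => p.2 ^+ m)).
    exact: (differentiable_comp_fst (is_derive_exprn j)).
  exact: (differentiable_comp_snd (is_derive_exprn m)).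
apply: (@differentiable_mulf (fun p => cos (a * p.1 + b * p.2 + c))
  (fun p => gaussian k p.1 * gaussian l p.2)).
  apply: (@differentiable_comp _ (R * R)%type R R
    (fun p : R * R => a * p.1 + b * p.2 + c) cos).
    apply: (@differentiableD _ (R * R)%type R
      (fun p : R * R => a * p.1 + b * p.2) (cst c)) => //.
    apply: (@differentiableD _ (R * R)%type R
      (fun p : R * R => a * p.1) (fun p => b * p.2)).
      exact: (differentiable_comp_fst (is_derive_mull a)).
    exact: (differentiable_comp_snd (is_derive_mull b)).
  by apply/derivable1_diffP; have [] := is_derive_cos (a * p.1 + b * p.2 + c).
apply: (@differentiable_mulf (fun p => gaussian k p.1) (fun p => gaussian l p.2)).
  exact: (differentiable_comp_fst (is_derive_gaussian k)).
exact: (differentiable_comp_snd (is_derive_gaussian l)).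
Qed.

Lemma derive_fst_wave j m c p :
  'D_(1, 0) (wave j m c : _ -> R^o) p =
  j%:R * wave j.-1 m c p
  + (a * wave j m (c + pi / 2) p - 2 * k * wave j.+1 m c p).
Proof.
case: p => x y; rewrite derive_fst/=.
under eq_fun do rewrite waveE_fst.
have [_ ->] := is_derive_wave1 k a j (b * y + c) (y ^+ m * gaussian l y) x.
by rewrite !waveE_fst -(addrA (b * y) c); ring.
Qed.

Lemma derive_snd_wave j m c p :
  'D_(0, 1) (wave j m c : _ -> R^o) p =
  m%:R * wave j m.-1 c p
  + (b * wave j m (c + pi / 2) p - 2 * l * wave j m.+1 c p).
Proof.
case: p => x y; rewrite derive_snd/=.
under eq_fun do rewrite waveE_snd.
have [_ ->] := is_derive_wave1 l b m (a * x + c) (x ^+ j * gaussian k x) y.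
by rewrite !waveE_snd -(addrA (a * x) c); ring.
Qed.

(** The partial derivatives of a wave are combinations of three waves, one of
them with its phase shifted by a quarter turn; the span of all waves is thus
stable under every derivative that occurs in the definition of the Schwartz
space. *)
Inductive wave_span : (R * R -> R) -> Prop :=
| wave_span0 : wave_span (fun=> 0)
| wave_span_cons r j m c f : wave_span f ->
    wave_span (fun p => r * wave j m c p + f p).

Lemma wave_span_wave r j m c : wave_span (fun p => r * wave j m c p).
Proof.
have := wave_span_cons r j m c wave_span0.
by under eq_fun do rewrite addr0.
Qed.

Lemma differentiable_wave_span f p : wave_span f ->
  differentiable (f : _ -> R^o) p.
Proof.
elim=> [|r j m c g _ dg]; first exact: (differentiable_cst (0 : R^o) p).
apply: (@differentiableD _ _ _ (fun p => r * wave j m c p : R^o) g) => //.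
exact: differentiableZ (differentiable_wave j m c p).
Qed.

Lemma derive_wave_span_cons (v : R * R) r j m c f p : wave_span f ->
  'D_v (fun p => r * wave j m c p + f p : R^o) p =
  r * 'D_v (wave j m c : _ -> R^o) p + 'D_v (f : _ -> R^o) p.
Proof.
move=> sf.
have dw := diff_derivable (v := v) (differentiable_wave j m c p).
rewrite (@deriveD _ _ _ (fun p => r * wave j m c p : R^o) f)//.
- by congr (_ + _); exact: (deriveZ r dw).
- by apply: diff_derivable; exact: differentiableZ (differentiable_wave j m c p).
- by apply: diff_derivable; exact: differentiable_wave_span.
Qed.

Lemma derive_fst_wave_span f : wave_span f ->
  wave_span (fun p => 'D_(1, 0) (f : _ -> R^o) p).
Proof.
elim=> [|r j m c g sg dg].
  rewrite (_ : (fun _ => _) = fun=> 0); first exact: wave_span0.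
  by apply/funext => p; exact: (derive_cst (0 : R^o) p).
(* x^j, cos and the Gaussian are differentiated in turn *)
have := wave_span_cons (r * j%:R) j.-1 m c (wave_span_cons (r * a) j m (c + pi / 2)
  (wave_span_cons (- (r * (2 * k))) j.+1 m c dg)).
congr wave_span; apply/funext => p.
by rewrite derive_wave_span_cons// derive_fst_wave; ring.
Qed.

Lemma derive_snd_wave_span f : wave_span f ->
  wave_span (fun p => 'D_(0, 1) (f : _ -> R^o) p).
Proof.
elim=> [|r j m c g sg dg].
  rewrite (_ : (fun _ => _) = fun=> 0); first exact: wave_span0.
  by apply/funext => p; exact: (derive_cst (0 : R^o) p).
have := wave_span_cons (r * m%:R) j m.-1 c (wave_span_cons (r * b) j m (c + pi / 2)
  (wave_span_cons (- (r * (2 * l))) j m.+1 c dg)).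
congr wave_span; apply/funext => p.
by rewrite derive_wave_span_cons// derive_snd_wave; ring.
Qed.

Hypotheses (k0 : 0 < k) (l0 : 0 < l).

Lemma wave_span_decay f J K : wave_span f ->
  exists M, forall p, `|p.1| ^+ J * `|p.2| ^+ K * `|f p| <= M.
Proof.
elim=> [|r j m c g _ [M gM]]; first by exists 0 => p; rewrite normr0 mulr0.
exists (`|r| * (expR ((J + j)%:R ^+ 2 / (4 * k)) *
                expR ((K + m)%:R ^+ 2 / (4 * l))) + M) => p.
rewrite (le_trans _ (lerD (lexx _) (gM p)))//.
have pn : 0 <= `|p.1| ^+ J * `|p.2| ^+ K by rewrite mulr_ge0 ?exprn_ge0.
rewrite (le_trans (ler_wpM2l pn (ler_normD _ _)))// mulrDr lerD2r.
rewrite normrM mulrCA ler_wpM2l//.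
have -> : `|wave j m c p| = `|cos (a * p.1 + b * p.2 + c)| *
    ((`|p.1| ^+ j * gaussian k p.1) * (`|p.2| ^+ m * gaussian l p.2)).
  rewrite /wave !normrM !normrX (ger0_norm (gaussian_ge0 _ _)).
  by rewrite (ger0_norm (gaussian_ge0 _ _)); ring.
rewrite mulrCA.
apply: (@le_trans _ _ ((`|p.1| ^+ (J + j) * gaussian k p.1) *
   (`|p.2| ^+ (K + m) * gaussian l p.2))).
  rewrite [leRHS](_ : _ = 1 * (`|p.1| ^+ J * `|p.2| ^+ K *
    (`|p.1| ^+ j * gaussian k p.1 * (`|p.2| ^+ m * gaussian l p.2)))).
    apply: ler_wpM2r; last exact: cos_max.
    by rewrite !mulr_ge0 ?exprn_ge0 ?gaussian_ge0.
  by rewrite !exprD; ring.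
by apply: ler_pM; rewrite ?mulr_ge0 ?exprn_ge0 ?gaussian_ge0//;
  exact: exprn_gaussian_le.
Qed.

Lemma schwartz_wave_span (u : R * R -> R[i]) :
  wave_span (fun p => complex.Re (u p)) ->
  wave_span (fun p => complex.Im (u p)) -> schwartz u.
Proof.
move=> su1 su2 m n /=.
set w := iter m _ _.
have [s1 s2] : wave_span (fun p => complex.Re (w p)) /\
    wave_span (fun p => complex.Im (w p)).
  rewrite {}/w; elim: m => [|m [IH1 IH2]] /=; last first.
    by split; [exact: derive_fst_wave_span IH1|exact: derive_fst_wave_span IH2].
  elim: n => [|n [IH1 IH2]] //=.
  by split; [exact: derive_snd_wave_span IH1|exact: derive_snd_wave_span IH2].
split=> [p|p|J K]; [exact: differentiable_wave_span|exact: differentiable_wave_span|].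
have [M1 h1] := wave_span_decay J K s1.
have [M2 h2] := wave_span_decay J K s2.
exists (M1 + M2) => p; apply: le_trans (lerD (h1 p) (h2 p)).
rewrite -mulrDr ler_wpM2l ?mulr_ge0 ?exprn_ge0//.
case: (w p) => x y /=.
rewrite -(ler_pXn2r (n := 2))// ?nnegrE ?sqrtr_ge0 ?addr_ge0//.
rewrite sqr_sqrtr ?addr_ge0 ?sqr_ge0// sqrrD !real_normK ?num_real//.
by rewrite -addrA lerD2l lerDr mulrn_wge0// mulr_ge0.
Qed.

End wave_span.

(** * Gabor packets: products, derivatives, Fourier transforms *)

Section gabor.
Local Open Scope complex_scope.
Context {R : realType}.
Local Notation mu := (@lebesgue_measure R).
Local Notation leb2 := (mu \x mu)%E.

Definition gabor (k l a b : R) (p : R * R) : R[i] :=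
  (cos (a * p.1 + b * p.2) * (gaussian k p.1 * gaussian l p.2)) +i*
  (sin (a * p.1 + b * p.2) * (gaussian k p.1 * gaussian l p.2)).

Lemma ReM (x y : R[i]) :
  complex.Re (x * y) = complex.Re x * complex.Re y - complex.Im x * complex.Im y.
Proof. by case: x; case: y. Qed.

Lemma ImM (x y : R[i]) :
  complex.Im (x * y) = complex.Re x * complex.Im y + complex.Im x * complex.Re y.
Proof. by case: x; case: y. Qed.

Lemma gaussianD (k k' x : R) :
  gaussian (k + k') x = gaussian k x * gaussian k' x.
Proof. by rewrite -expRD; congr expR; ring. Qed.

(** A product of packets is again a packet: frequencies add, and so do the
exponents of the Gaussians. *)
Lemma gaborM (k l a b k' l' a' b' : R) p :
  gabor k l a b p * gabor k' l' a' b' p = gabor (k + k') (l + l') (a + a') (b + b') p.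
Proof.
apply/eqP; rewrite eq_complex ReM ImM /=.
rewrite (gaussianD k k' p.1) (gaussianD l l' p.2).
have -> : (a + a') * p.1 + (b + b') * p.2 =
  (a * p.1 + b * p.2) + (a' * p.1 + b' * p.2) by ring.
set A := a * p.1 + b * p.2; set B := a' * p.1 + b' * p.2.
by rewrite (cosD A B) (sinD A B); apply/andP; split; apply/eqP; ring.
Qed.

Lemma schwartz_gabor (k l a b : R) : 0 < k -> 0 < l -> schwartz (gabor k l a b).
Proof.
move=> k0 l0; apply: (@schwartz_wave_span _ k l a b) => //.
  have := wave_span_wave k l a b 1 0 0 0.
  congr wave_span; apply/funext => p.
  by rewrite /wave /= !expr0 !mul1r addr0.
have := wave_span_wave k l a b 1 0 0 (- (pi / 2)).
congr wave_span; apply/funext => p.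
by rewrite /wave /= !expr0 !mul1r cosBpihalf.
Qed.

Lemma Re_expNi_gabor k l a b (q p : R * R) :
  complex.Re (expNi (p.1 * q.1 + p.2 * q.2) * gabor k l a b p) =
  cos ((a - q.1) * p.1 + (b - q.2) * p.2 + 0) * (gaussian k p.1 * gaussian l p.2).
Proof.
rewrite ReM /= (_ : _ + 0 = (a * p.1 + b * p.2) - (p.1 * q.1 + p.2 * q.2)); last by ring.
by rewrite cosB; ring.
Qed.

Lemma Im_expNi_gabor k l a b (q p : R * R) :
  complex.Im (expNi (p.1 * q.1 + p.2 * q.2) * gabor k l a b p) =
  sin ((a - q.1) * p.1 + (b - q.2) * p.2 + 0) * (gaussian k p.1 * gaussian l p.2).
Proof.
rewrite ImM /= (_ : _ + 0 = (a * p.1 + b * p.2) - (p.1 * q.1 + p.2 * q.2)); last by ring.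
by rewrite sinB; ring.
Qed.

Lemma fourier_gabor k l a b q : 0 < k -> 0 < l ->
  fourier (gabor k l a b) q =
  (gaussian_hat k (a - q.1) * gaussian_hat l (b - q.2)) +i* 0.
Proof.
move=> k0 l0; congr (_ +i* _).
  under eq_Rintegral do rewrite Re_expNi_gabor.
  by rewrite Rintegral_cos_gabor// cos0 mul1r.
under eq_Rintegral do rewrite Im_expNi_gabor.
by rewrite Rintegral_sin_gabor// sin0 mul0r.
Qed.

Lemma partial_x_gabor k l a b p :
  partial_x (gabor k l a b) p = ((- (2 * k * p.1)) +i* a) * gabor k l a b p.
Proof.
have D c r : 'D_(1, 0) (fun q : R * R => r * wave k l a b 0 0 c q : R^o) p =
   r * (a * wave k l a b 0 0 (c + pi / 2) p - 2 * k * p.1 * wave k l a b 0 0 c p).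
  rewrite (deriveZ r); last by apply: diff_derivable; exact: differentiable_wave.
  rewrite derive_fst_wave mul0r add0r /GRing.scale/=; congr (_ * (_ - _)).
  by rewrite /wave; ring.
have E1 : (fun q => complex.Re (gabor k l a b q)) = (fun q => 1 * wave k l a b 0 0 0 q).
  by apply/funext => q; rewrite /wave /= !expr0 !mul1r addr0.
have E2 : (fun q => complex.Im (gabor k l a b q)) =
    (fun q => 1 * wave k l a b 0 0 (- (pi / 2)) q).
  by apply/funext => q; rewrite /wave /= !expr0 !mul1r cosBpihalf.
apply/eqP; rewrite eq_complex ReM ImM /partial_x /partial E1 E2 !D.
rewrite /wave /= !expr0 !mul1r add0r addNr cosBpihalf cosDpihalf !addr0.
by apply/andP; split; apply/eqP; ring.
Qed.

(** The derivative brings out the factor i a - 2 k x.  The term i a contributes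
i a times the transform of the packet, and the term in x contributes
- i (a - xi) times it, by integration by parts; what remains is i xi. *)
Lemma fourier_partial_x_gabor k l a b q : 0 < k -> 0 < l ->
  fourier (partial_x (gabor k l a b)) q =
  0 +i* (q.1 * (gaussian_hat k (a - q.1) * gaussian_hat l (b - q.2))).
Proof.
move=> k0 l0.
pose A := a - q.1; pose B := b - q.2.
pose C (p : R * R) := cos (A * p.1 + B * p.2 + 0) * (gaussian k p.1 * gaussian l p.2).
pose S (p : R * R) := sin (A * p.1 + B * p.2 + 0) * (gaussian k p.1 * gaussian l p.2).
have iC : leb2.-integrable setT (EFin \o C).
  have := integrable_cos_gaussian2 0 A B 0 k0 l0.
  by under eq_fun do rewrite expr0 mul1r.
have iS : leb2.-integrable setT (EFin \o S).
  have := integrable_sin_gaussian2 0 A B 0 k0 l0.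
  by under eq_fun do rewrite expr0 mul1r.
have ixC : leb2.-integrable setT (EFin \o (fun p : R * R => p.1 * C p)).
  have := integrable_cos_gaussian2 1 A B 0 k0 l0.
  by under eq_fun do rewrite expr1.
have ixS : leb2.-integrable setT (EFin \o (fun p : R * R => p.1 * S p)).
  have := integrable_sin_gaussian2 1 A B 0 k0 l0.
  by under eq_fun do rewrite expr1.
have Z r (f : R * R -> R) : leb2.-integrable setT (EFin \o f) ->
    leb2.-integrable setT (EFin \o (fun p => r * f p)).
  by move=> fi; exact: (integrableZl _ r fi).
congr (_ +i* _).
  under eq_Rintegral => p _.
    rewrite partial_x_gabor mulrCA ReM Re_expNi_gabor Im_expNi_gabor /=.
    rewrite -/A -/B -/(C p) -/(S p).
    rewrite (_ : _ - _ = - (2 * k) * (p.1 * C p) + - a * S p); last by ring.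
    over.
  rewrite RintegralD ?RintegralZl//; [|exact: Z..].
  rewrite Rintegral_mul_cos_gabor// Rintegral_sin_gabor// sin0; ring.
under eq_Rintegral => p _.
  rewrite partial_x_gabor mulrCA ImM Re_expNi_gabor Im_expNi_gabor /=.
  rewrite -/A -/B -/(C p) -/(S p).
  rewrite (_ : _ + _ = - (2 * k) * (p.1 * S p) + a * C p); last by ring.
  over.
rewrite RintegralD ?RintegralZl//; [|exact: Z..].
rewrite Rintegral_mul_sin_gabor// Rintegral_cos_gabor// cos0 /A /B.
by field; rewrite gt_eqF.
Qed.

End gabor.

(** * Pointwise bounds on the weights *)

Section weights.
Context {R : realType}.
Implicit Types (x y s b : R).

Lemma bracket_ge1 x : 1 <= bracket x.
Proof. by rewrite lerDl. Qed.

Lemma bracket_gt0 x : 0 < bracket x.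
Proof. exact: lt_le_trans (bracket_ge1 x). Qed.

Lemma bracket_ge0 x : 0 <= bracket x.
Proof. exact: ltW (bracket_gt0 x). Qed.

(** Brackets are submultiplicative, which is why weights can be transported from
one point to another at the price of a bracket of the difference. *)
Lemma bracketD_le x y : bracket (x + y) <= bracket x * bracket y.
Proof.
rewrite /bracket; have := ler_normD x y.
have : 0 <= `|x| * `|y| by rewrite mulr_ge0.
by rewrite mulrDl mul1r mulrDr mulr1; lra.
Qed.

Lemma powR_bracket_le_expR x b : 0 <= b -> bracket x `^ b <= expR (b * `|x|).
Proof.
move=> b0; rewrite mulrC expRM; apply: (ge0_ler_powR b0); last exact: expR_ge1Dx.
  by rewrite nnegrE ltW// bracket_gt0.
by rewrite nnegrE expR_ge0.
Qed.

Lemma ler_powR_npos s x y : s <= 0 -> 0 < x -> x <= y -> y `^ s <= x `^ s.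
Proof.
move=> s0 x0 xy; have y0 := lt_le_trans x0 xy.
rewrite -[s]opprK !(powRN _ (- s)) lef_pV2 ?posrE ?powR_gt0//.
by rewrite ge0_ler_powR ?oppr_ge0// nnegrE ltW.
Qed.

Lemma powR_le_norm b x y : 1 <= x -> x <= y -> x `^ b <= y `^ `|b|.
Proof.
move=> x1 xy; apply: (@le_trans _ _ (x `^ `|b|)).
  by rewrite ler_powR// ler_norm.
by apply: (ge0_ler_powR (normr_ge0 b)) => //; rewrite nnegrE; lra.
Qed.

Lemma powR_ge_norm b x y : 1 <= x -> x <= y -> (y `^ `|b|)^-1 <= x `^ b.
Proof.
move=> x1 xy; have x0 : 0 < x by lra.
rewrite -[X in _ <= _ `^ X]opprK (powRN _ (- b)) -normrN.
rewrite lef_pV2 ?posrE ?powR_gt0 ?(lt_le_trans x0)//.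
exact: powR_le_norm.
Qed.

(** A constant large enough for the expansion of beta (xi^3 - (c N)^3) in powers
of xi - c N, once xi - c N is measured in units of N^-2. *)
Definition curvature (beta c : R) : R :=
  1 + `|beta| * (3 * c ^+ 2 + 3 * `|c| + 1).

(** With y = N^2 (xi - c N), the difference xi^3 - (c N)^3 equals
3 c^2 y + 3 c y^2 / N^3 + y^3 / N^6, so moving along the curve at scale N^-2
changes the modulation by a quantity that does not grow with N. *)
Lemma bracket_modulation_le (beta c N xi tau : R) : 1 <= N ->
  bracket (tau - beta * xi ^+ 3) <=
  curvature beta c * bracket (N ^+ 2 * (xi - c * N)) ^+ 3 *
  bracket (tau - beta * (c * N) ^+ 3).
Proof.
move=> N1; have N0 : N != 0 by lra.
set y := N ^+ 2 * (xi - c * N); set z := tau - _ * (c * N) ^+ 3.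
pose v := N^-1.
have v0 : 0 <= v by rewrite invr_ge0; lra.
have v1 : v <= 1 by rewrite invf_le1; lra.
have E : tau - beta * xi ^+ 3 = z - beta *
    (3 * c ^+ 2 * y + 3 * c * v ^+ 3 * y ^+ 2 + v ^+ 6 * y ^+ 3).
  by rewrite /z /y /v; field.
have P : `|3 * c ^+ 2 * y + 3 * c * v ^+ 3 * y ^+ 2 + v ^+ 6 * y ^+ 3| <=
    (3 * c ^+ 2 + 3 * `|c| + 1) * bracket y ^+ 3.
  have y0 : 0 <= `|y| by [].
  have y1 : `|y| <= bracket y ^+ 3 by rewrite /bracket; nra.
  have y2 : `|y| ^+ 2 <= bracket y ^+ 3 by rewrite /bracket; nra.
  have y3 : `|y| ^+ 3 <= bracket y ^+ 3.
    by rewrite lerXn2r ?nnegrE// /bracket; lra.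
  rewrite [leRHS](_ : _ = 3 * c ^+ 2 * bracket y ^+ 3
    + 3 * `|c| * bracket y ^+ 3 + bracket y ^+ 3); last by ring.
  rewrite (le_trans (ler_normD _ _))// lerD//.
    rewrite (le_trans (ler_normD _ _))// lerD//.
      have c2 : 0 <= 3 * c ^+ 2 by rewrite mulr_ge0 ?sqr_ge0.
      by rewrite normrM (ger0_norm c2) ler_wpM2l.
    rewrite (normrM (3 * c * _)) (normrM (3 * c)) (normrM 3) !normrX.
    rewrite (ger0_norm v0) (ger0_norm (ler0n R 3)) -[leLHS]mulrA.
    rewrite ler_wpM2l// ?mulr_ge0//.
    by rewrite (le_trans _ y2)// ler_piMl ?exprn_ge0// exprn_ile1.
  rewrite (normrM (v ^+ 6)) !normrX (ger0_norm v0).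
  by rewrite (le_trans _ y3)// ler_piMl ?exprn_ge0// exprn_ile1.
rewrite E {E}.
set Q := (_ + _ * y ^+ 3) in P *.
set B := bracket y ^+ 3 in P *.
have B1 : 1 <= B by rewrite exprn_ege1// bracket_ge1.
set D := 3 * c ^+ 2 + 3 * `|c| + 1 in P.
have D0 : 0 <= D by have := sqr_ge0 c; have := normr_ge0 c; rewrite /D; lra.
rewrite /curvature -/D.
have H : bracket (z - beta * Q) <= bracket z * (1 + `|beta| * (D * B)).
  apply: le_trans (bracketD_le _ _) _.
  rewrite ler_wpM2l ?bracket_ge0// /bracket lerD2l normrN normrM.
  by rewrite ler_wpM2l.
apply: le_trans H _; rewrite mulrC ler_wpM2r ?bracket_ge0//.
have -> : (1 + `|beta| * D) * B = B + `|beta| * (D * B) by ring.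
by rewrite lerD2r.
Qed.

(** Up to the factor N^s, the weight grows at most exponentially in the distance
to the centre of the packet, measured in the units of the packet.  The sign of
s matters: bracket (c N) is at most bracket xi times bracket y, and the power s
reverses this inequality. *)
Lemma weight_le (beta c s b N xi tau : R) : s <= 0 -> c != 0 -> 1 <= N ->
  bracket xi `^ s * bracket (tau - beta * xi ^+ 3) `^ b <=
  `|c| `^ s * curvature beta c `^ `|b| * N `^ s *
  (expR ((3 * `|b| - s) * `|N ^+ 2 * (xi - c * N)|) *
   expR (`|b| * `|tau - beta * (c * N) ^+ 3|)).
Proof.
move=> s0 c0 N1; have N0 : 0 < N by lra.
have cp : 0 < `|c| by rewrite normr_gt0.
have A1 : 1 <= curvature beta c.
  by rewrite lerDl mulr_ge0//; have := sqr_ge0 c; lra.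
set y := N ^+ 2 * (xi - c * N); set z := tau - _ * (c * N) ^+ 3.
have B0 := bracket_ge1 y; have Bz := bracket_ge1 z.
have H1 : bracket xi `^ s <= `|c| `^ s * N `^ s * expR (- s * `|y|).
  have X0 : `|c| * N <= bracket xi * bracket y.
    apply: (@le_trans _ _ (bracket (c * N))).
      by rewrite /bracket (normrM c) (gtr0_norm N0) lerDr.
    apply: (@le_trans _ _ (bracket xi * bracket (c * N - xi))).
      by have := bracketD_le xi (c * N - xi); rewrite addrCA subrr addr0.
    rewrite ler_wpM2l ?bracket_ge0// /bracket lerD2l /y (normrM (N ^+ 2)) distrC.
    by rewrite ler_peMl// ger0_norm ?sqr_ge0// exprn_ege1.
  have := ler_powR_npos s0 (mulr_gt0 cp N0) X0.
  rewrite !powRM ?bracket_ge0 ?(ltW N0)// => H.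
  have Y0 : 0 < bracket y `^ s by rewrite powR_gt0// bracket_gt0.
  apply: (@le_trans _ _ (`|c| `^ s * N `^ s / bracket y `^ s)).
    by rewrite ler_pdivlMr.
  rewrite ler_wpM2l ?mulr_ge0 ?powR_ge0// -powRN.
  by apply: powR_bracket_le_expR; rewrite oppr_ge0.
have H2 : bracket (tau - beta * xi ^+ 3) `^ b <=
    curvature beta c `^ `|b| * (expR (3 * `|b| * `|y|) * expR (`|b| * `|z|)).
  have := powR_le_norm b (bracket_ge1 _) (bracket_modulation_le beta c xi tau N1).
  rewrite -/y -/z => /le_trans; apply.
  have A0 : 0 <= curvature beta c by lra.
  have B3 : 0 <= bracket y ^+ 3 by rewrite exprn_ge0// bracket_ge0.
  have BB : 0 <= bracket y ^+ 3 * bracket z by rewrite mulr_ge0// bracket_ge0.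
  rewrite -mulrA (powRM _ A0 BB) (powRM _ B3 (bracket_ge0 z)).
  rewrite ler_wpM2l ?powR_ge0//.
  apply: ler_pM; rewrite ?powR_ge0//; last exact: powR_bracket_le_expR.
  rewrite -(powR_mulrn 3 (bracket_ge0 y)).
  by rewrite -powRrM; apply: powR_bracket_le_expR; rewrite mulr_ge0.
apply: le_trans (ler_pM (powR_ge0 _ _) (powR_ge0 _ _) H1 H2) _.
rewrite mulrBl expRD mulNr; lra.
Qed.

End weights.

(** * Square norms over the plane *)

Section norms.
Context {R : realType}.
Local Notation mu := (@lebesgue_measure R).
Local Notation leb2 := (mu \x mu)%E.
Local Notation R2 := (measurableTypeR R * measurableTypeR R)%type.
Local Notation L2 f := (Lnorm leb2 2%:E (fun q => (f q)%:E)).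

Lemma Lnorm2E (f : R2 -> R) :
  L2 f = ((\int[leb2]_q (f q ^+ 2)%:E) `^ 2^-1)%E.
Proof.
rewrite unlock; congr (_ `^ _)%E; apply: eq_integral => q _.
by rewrite /= powR_mulrn// real_normK// num_real.
Qed.

Lemma sqr_poweR_half (r : R) : 0 <= r -> ((r ^+ 2)%:E `^ 2^-1)%E = r%:E.
Proof. by move=> r0; rewrite poweR_EFin powR12_sqrt ?sqr_ge0// sqrtr_sqr ger0_norm. Qed.

Lemma integral_sqr_ge0 (f : R2 -> R) : (0 <= \int[leb2]_q (f q ^+ 2)%:E)%E.
Proof. by apply: integral_ge0 => q _; rewrite lee_fin sqr_ge0. Qed.

Lemma Lnorm2_le (f : R2 -> R) (r : R) : 0 <= r ->
  (\int[leb2]_q (f q ^+ 2)%:E <= (r ^+ 2)%:E)%E -> (L2 f <= r%:E)%E.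
Proof.
move=> r0 fr; rewrite Lnorm2E -(sqr_poweR_half r0).
apply: gt0_ler_poweR => //; rewrite in_itv/= leey andbT.
  exact: integral_sqr_ge0.
by rewrite lee_fin sqr_ge0.
Qed.

Lemma Lnorm2_ge (f : R2 -> R) (r : R) : 0 <= r ->
  ((r ^+ 2)%:E <= \int[leb2]_q (f q ^+ 2)%:E)%E -> (r%:E <= L2 f)%E.
Proof.
move=> r0 fr; rewrite Lnorm2E -(sqr_poweR_half r0).
apply: gt0_ler_poweR => //; rewrite in_itv/= leey andbT.
  by rewrite lee_fin sqr_ge0.
exact: integral_sqr_ge0.
Qed.

Lemma continuous_shift_gaussian (k m : R) : continuous (fun x : R => gaussian k (x - m)).
Proof.
move=> x; apply: (@continuous_comp _ _ _ (fun x : R => x - m) (gaussian k)).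
  by apply: (@cvgB _ R^o); [exact: cvg_id|exact: cvg_cst].
exact: continuous_gaussian.
Qed.

Lemma Lnorm2_gaussian_le (f : R2 -> R) (K k l x0 t0 : R) :
  measurable_fun setT f -> 0 < k -> 0 < l -> 0 <= K ->
  (forall q, 0 <= f q <= K * (gaussian k (q.1 - x0) * gaussian l (q.2 - t0))) ->
  (L2 f <= (K * Num.sqrt (Num.sqrt (pi / (2 * k)) * Num.sqrt (pi / (2 * l))))%:E)%E.
Proof.
move=> mf k0 l0 K0 fK; apply: Lnorm2_le; first by rewrite mulr_ge0.
pose gk (x : R) := gaussian (2 * k) (x - x0).
pose gl (x : R) := gaussian (2 * l) (x - t0).
have k20 : 0 < 2 * k by rewrite mulr_gt0.
have l20 : 0 < 2 * l by rewrite mulr_gt0.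
have cgk : continuous gk := @continuous_shift_gaussian (2 * k) x0.
have cgl : continuous gl := @continuous_shift_gaussian (2 * l) t0.
have mg : measurable_fun [set: R2] (fun q : R2 => K ^+ 2 * (gk q.1 * gl q.2)).
  apply: measurable_funM => //; apply: measurable_funM.
    exact: (measurable_continuous_fst cgk).
  exact: (measurable_continuous_snd cgl).
apply: (@le_trans _ _ (\int[leb2]_q (K ^+ 2 * (gk q.1 * gl q.2))%:E)%E).
  apply: ge0_le_integral => //.
  - by move=> q _; rewrite lee_fin sqr_ge0.
  - by apply/measurable_EFinP; exact: measurable_funX.
  - exact/measurable_EFinP.
  - move=> q _; rewrite lee_fin /gk /gl.
    have /andP[f0 fle] := fK q.
    apply: (@le_trans _ _ ((K * (gaussian k (q.1 - x0) * gaussian l (q.2 - t0))) ^+ 2)).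
      by rewrite lerXn2r ?nnegrE// (le_trans f0).
    rewrite (gaussian_half (2 * k)) (gaussian_half (2 * l)).
    rewrite (_ : 2 * k / 2 = k); last by field.
    rewrite (_ : 2 * l / 2 = l); last by field.
    by rewrite le_eqVlt; apply/orP; left; apply/eqP; ring.
rewrite fubini_tonelli1; last 2 first.
- exact/measurable_EFinP.
- by move=> q; rewrite lee_fin mulr_ge0 ?sqr_ge0// mulr_ge0 ?gaussian_ge0.
have mgk := continuous_measurable_EFin cgk.
have mgl := continuous_measurable_EFin cgl.
pose I (k : R) := Num.sqrt (pi / k).
have E x : fubini_F mu (fun q : R2 => (K ^+ 2 * (gk q.1 * gl q.2))%:E) x =
    ((K ^+ 2 * I (2 * l))%:E * (gk x)%:E)%E.
  rewrite /fubini_F/= /I [in RHS]EFinM -(integral_shift_gaussian t0 l20).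
  rewrite muleAC -EFinM -ge0_integralZl//.
  - by apply: eq_integral => y _; rewrite -EFinM mulrA.
  - by move=> y _; rewrite lee_fin gaussian_ge0.
  - by rewrite lee_fin mulr_ge0 ?sqr_ge0 ?gaussian_ge0.
under eq_integral do rewrite E.
rewrite ge0_integralZl//; last 2 first.
- by move=> x _; rewrite lee_fin gaussian_ge0.
- by rewrite lee_fin mulr_ge0 ?sqr_ge0 ?sqrtr_ge0.
rewrite (integral_shift_gaussian x0 k20) -EFinM lee_fin exprMn.
by rewrite sqr_sqrtr ?mulr_ge0// /I -mulrA (mulrC (Num.sqrt (pi / (2 * l)))).
Qed.

(** The square of f is at least m^2 on a box of area 4 d e. *)
Lemma Lnorm2_box_ge (f : R2 -> R) (m x0 t0 d e : R) :
  measurable_fun setT f -> 0 <= m -> 0 < d -> 0 < e ->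
  (forall q, `|q.1 - x0| <= d -> `|q.2 - t0| <= e -> m <= f q) ->
  ((m * (2 * Num.sqrt (d * e)))%:E <= L2 f)%E.
Proof.
move=> mf m0 d0 e0 fm; apply: Lnorm2_ge; first by rewrite !mulr_ge0.
pose I1 := `[x0 - d, x0 + d]%classic; pose I2 := `[t0 - e, t0 + e]%classic.
pose E : set R2 := I1 `*` I2.
have mE : measurable E by apply: measurableX; exact: measurable_itv.
have itvE (y r : R) : 0 < r -> mu `[y - r, y + r] = (2 * r)%:E.
  move=> r0; rewrite lebesgue_measure_itv/= lte_fin ltrD2l gtrN// -EFinB.
  by congr EFin; ring.
have muE : leb2 E = (4 * (d * e))%:E.
  transitivity (mu I1 * mu I2)%E.
    by apply: product_measure1E; exact: measurable_itv.
  by rewrite !itvE// -EFinM; congr EFin; ring.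
have mf2 : measurable_fun [set: R2] (fun q => (f q ^+ 2)%:E).
  by apply/measurable_EFinP; exact: measurable_funX.
apply: (@le_trans _ _ (\int[leb2]_(q in E) (f q ^+ 2)%:E)%E); last first.
  by apply: ge0_subset_integral => // q _; rewrite lee_fin sqr_ge0.
apply: (@le_trans _ _ (\int[leb2]_(q in E) (cst (m ^+ 2)%:E) q)%E).
  rewrite integral_cst// [X in (_ * X)%E](_ : _ = (4 * (d * e))%:E)//.
  rewrite -EFinM lee_fin !exprMn sqr_sqrtr; last first.
    by rewrite mulr_ge0 ?(ltW d0) ?(ltW e0).
  by rewrite le_eqVlt; apply/orP; left; apply/eqP; ring.
apply: ge0_le_integral => //.
- by move=> q _; rewrite lee_fin sqr_ge0.
- exact: measurable_funTS.
- move=> q [/=]; rewrite /I1 /I2 /= !in_itv/= => /andP[q1 q2] /andP[q3 q4].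
  have mfq : m <= f q by apply: fm; rewrite ler_distl; apply/andP; split; lra.
  by rewrite lee_fin lerXn2r ?nnegrE// (le_trans m0).
Qed.

End norms.

(** * Norms of packets and failure of the estimates *)

Section gabor_norms.
Context {R : realType}.
Local Notation mu := (@lebesgue_measure R).
Local Notation leb2 := (mu \x mu)%E.
Local Notation R2 := (measurableTypeR R * measurableTypeR R)%type.

Lemma gaussian_hat_ge0 (k a : R) : 0 <= gaussian_hat k a.
Proof. by rewrite mulr_ge0 ?sqrtr_ge0// gaussian_ge0. Qed.

(** Stretching a Gaussian by N^2 in x narrows its transform by the same factor and
raises it by N^2. *)
Lemma gaussian_hat_scale (k N d : R) : 0 < k -> 0 < N ->
  gaussian_hat (k / N ^+ 4) d = N ^+ 2 * gaussian_hat k (N ^+ 2 * d).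
Proof.
move=> k0 N0; rewrite /gaussian_hat.
have -> : pi / (k / N ^+ 4) = pi / k * (N ^+ 2) ^+ 2.
  by field; rewrite !gt_eqF.
rewrite sqrtrM ?divr_ge0 ?pi_ge0 ?(ltW k0)// sqrtr_sqr ger0_norm ?sqr_ge0//.
have -> : gaussian (4 * (k / N ^+ 4))^-1 d = gaussian (4 * k)^-1 (N ^+ 2 * d).
  by congr expR; field; rewrite !gt_eqF.
ring.
Qed.

Lemma gaussian_hatN (k a : R) : gaussian_hat k (- a) = gaussian_hat k a.
Proof. by rewrite /gaussian_hat /gaussian sqrrN. Qed.

Lemma measurable_bourgain_weight (beta s b : R) :
  measurable_fun [set: R2]
    (fun q => bracket q.1 `^ s * bracket (q.2 - beta * q.1 ^+ 3) `^ b).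
Proof.
have mb (f : R2 -> R) (r : R) : measurable_fun setT f ->
    measurable_fun setT (fun q => bracket (f q) `^ r).
  move=> mf; apply: (measurableT_comp (measurable_powR r)).
  by apply: measurable_funD => //; exact: measurableT_comp.
apply: measurable_funM; apply: mb => //.
apply: measurable_funB => //; apply: measurable_funM => //.
by apply: measurable_funX.
Qed.

Lemma measurable_gaussian_hat2 (k l a b : R) :
  measurable_fun [set: R2]
    (fun q => gaussian_hat k (a - q.1) * gaussian_hat l (b - q.2)).
Proof.
have c (k' a' : R) : continuous (fun x : R => gaussian_hat k' (a' - x)).
  move=> x; apply: cvgM; first exact: cvg_cst.
  apply: (@continuous_comp _ _ _ (fun x : R => a' - x) (gaussian _)).
    by apply: (@cvgB _ R^o); [exact: cvg_cst|exact: cvg_id].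
  exact: continuous_gaussian.
apply: measurable_funM; first exact: (measurable_continuous_fst (c k a)).
exact: (measurable_continuous_snd (c l b)).
Qed.

Lemma Xnorm_gaborE (beta s b k l x0 t0 : R) : 0 < k -> 0 < l ->
  Xnorm_ beta s b (gabor k l x0 t0) = Lnorm leb2 2%:E (fun q => (
    bracket q.1 `^ s * bracket (q.2 - beta * q.1 ^+ 3) `^ b *
    (gaussian_hat k (x0 - q.1) * gaussian_hat l (t0 - q.2)))%:E).
Proof.
move=> k0 l0; congr Lnorm; apply/funext => q; rewrite fourier_gabor//=.
rewrite expr0n addr0 sqrtr_sqr ger0_norm// mulr_ge0//; exact: gaussian_hat_ge0.
Qed.

Lemma Xnorm_partial_x_gaborE (beta s b k l x0 t0 : R) : 0 < k -> 0 < l ->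
  Xnorm_ beta s b (partial_x (gabor k l x0 t0)) = Lnorm leb2 2%:E (fun q => (
    bracket q.1 `^ s * bracket (q.2 - beta * q.1 ^+ 3) `^ b *
    (`|q.1| * (gaussian_hat k (x0 - q.1) * gaussian_hat l (t0 - q.2))))%:E).
Proof.
move=> k0 l0; congr Lnorm; apply/funext => q; rewrite fourier_partial_x_gabor//=.
rewrite expr0n add0r sqrtr_sqr normrM (ger0_norm (_ : 0 <= _ * _))//.
by rewrite mulr_ge0//; exact: gaussian_hat_ge0.
Qed.

(** The amplitude of the transform is of order N^2 and the square root of the
area of its support of order N^-1, hence the factor N beside the weight N^s. *)
Lemma Xnorm_gabor_le (beta s b c : R) : s <= 0 -> c != 0 ->
  exists2 K, 0 <= K & forall N, 1 <= N ->
    (Xnorm_ beta s b (gabor (1 / N ^+ 4) 1 (c * N) (beta * (c * N) ^+ 3)) <=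
     (K * (N `^ s * N))%:E)%E.
Proof.
move=> s0 c0.
pose C := `|c| `^ s * curvature beta c `^ `|b|.
pose P : R := Num.sqrt (pi / 1).
(* half of the exponent of gaussian_hat 1; the other half absorbs the weight *)
pose h : R := (4 * 1)^-1 / 2.
have h0 : 0 < h by rewrite /h; lra.
pose m := 3 * `|b| - s.
pose M1 := expR (m ^+ 2 / (4 * h)).
pose M2 := expR (`|b| ^+ 2 / (4 * h)).
pose S : R := Num.sqrt (pi / (2 * h)).
have C0 : 0 <= C by rewrite mulr_ge0 ?powR_ge0.
have P0 : 0 <= P := sqrtr_ge0 _.
have S0 : 0 <= S := sqrtr_ge0 _.
exists (C * P ^+ 2 * (M1 * M2) * S).
  by rewrite !mulr_ge0 ?powR_ge0 ?sqr_ge0 ?expR_ge0.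
move=> N N1; have N0 : 0 < N by lra.
have k0 : 0 < 1 / N ^+ 4 by rewrite divr_gt0 ?exprn_gt0.
rewrite Xnorm_gaborE//.
set t1 := beta * _.
pose K' := C * N `^ s * N ^+ 2 * P ^+ 2 * (M1 * M2).
have K'0 : 0 <= K'.
  by rewrite !mulr_ge0 ?powR_ge0 ?sqr_ge0 ?expR_ge0 ?(ltW N0).
have hN0 : 0 < h * N ^+ 4 by rewrite mulr_gt0 ?exprn_gt0.
have -> : C * P ^+ 2 * (M1 * M2) * S * (N `^ s * N) =
    K' * Num.sqrt (Num.sqrt (pi / (2 * (h * N ^+ 4))) * Num.sqrt (pi / (2 * h))).
  have -> : pi / (2 * (h * N ^+ 4)) = pi / (2 * h) * (N ^- 2) ^+ 2.
    by field; rewrite !gt_eqF.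
  rewrite (sqrtrM ((N ^- 2) ^+ 2)) ?divr_ge0 ?pi_ge0 ?mulr_ge0 ?(ltW h0)//.
  rewrite sqrtr_sqr ger0_norm ?invr_ge0 ?sqr_ge0// -/S.
  have -> : S * N ^- 2 * S = (S / N) ^+ 2 by field; rewrite gt_eqF.
  rewrite sqrtr_sqr ger0_norm; last by rewrite divr_ge0// ltW.
  by rewrite /K'; field; rewrite gt_eqF.
apply: (@Lnorm2_gaussian_le _ _ _ _ _ (c * N) t1) => //.
  apply: measurable_funM; first exact: measurable_bourgain_weight.
  exact: measurable_gaussian_hat2.
move=> q; apply/andP; split.
  by apply: mulr_ge0; apply: mulr_ge0; rewrite ?powR_ge0 ?gaussian_hat_ge0.
rewrite gaussian_hat_scale// -(gaussian_hatN _ (_ * _)) -(gaussian_hatN 1 (t1 - _)).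
rewrite -(mulrN (N ^+ 2)) (opprB (c * N)) (opprB t1).
set y := N ^+ 2 * (q.1 - c * N); set z := q.2 - t1.
have gE x : gaussian_hat 1 x = P * (gaussian h x * gaussian h x).
  by rewrite /gaussian_hat (gaussian_half (4 * 1)^-1).
have -> : gaussian (h * N ^+ 4) (q.1 - c * N) = gaussian h y.
  by congr expR; rewrite /y; ring.
have W := weight_le beta b q.1 q.2 s0 c0 N1.
rewrite -/y -/t1 -/z -/m in W.
have E1 := expR_mul_gaussian_le m y h0.
have E2 := expR_mul_gaussian_le `|b| z h0.
rewrite -/M1 in E1; rewrite -/M2 in E2.
rewrite !gE.
set gy := gaussian h y in E1 *; set gz := gaussian h z in E2 *.
have gy0 : 0 <= gy by exact: gaussian_ge0.
have gz0 : 0 <= gz by exact: gaussian_ge0.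
set G := N ^+ 2 * _ * _.
have G0 : 0 <= G by rewrite !mulr_ge0 ?(ltW N0).
apply: le_trans (ler_wpM2r G0 W) _; rewrite /G.
have E12 := ler_pM (mulr_ge0 (expR_ge0 _) gy0) (mulr_ge0 (expR_ge0 _) gz0) E1 E2.
set D := C * N `^ s * N ^+ 2 * P ^+ 2 * (gy * gz).
have D0 : 0 <= D by rewrite !mulr_ge0 ?powR_ge0 ?(ltW N0).
have := ler_wpM2l D0 E12; rewrite /D /K' /C.
set X1 := expR (m * _); set X2 := expR (_ * `|z|).
by move=> H; apply: le_trans (le_trans H _); rewrite le_eqVlt; apply/orP; left;
  apply/eqP; ring.
Qed.

(** As in the upper bound, with a further factor N from the derivative.  The
condition 2 <= |c| N keeps xi away from 0 on the box: it makes |xi| at least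
|c| N / 2 there. *)
Lemma Xnorm_partial_x_gabor_ge (beta s b c : R) : s <= 0 -> c != 0 ->
  exists2 K, 0 < K & forall N, 1 <= N -> 2 <= `|c| * N ->
    ((K * (N `^ s * N ^+ 2))%:E <=
     Xnorm_ beta s b
       (partial_x (gabor (2 / N ^+ 4) 2 (c * N) (beta * (c * N) ^+ 3))))%E.
Proof.
move=> s0 c0.
have cp : 0 < `|c| by rewrite normr_gt0.
have A1 : 1 <= curvature beta c.
  by rewrite lerDl mulr_ge0//; have := sqr_ge0 c; lra.
(* on the box both brackets in bracket_modulation_le are at most 2 *)
pose A := (curvature beta c * 2 ^+ 3 * 2) `^ `|b|.
pose P : R := Num.sqrt (pi / 2).
pose h : R := (4 * 2)^-1.
have h0 : 0 < h by rewrite /h invr_gt0; lra.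
have A0 : 0 < A by rewrite powR_gt0 ?mulr_gt0 ?exprn_gt0//; lra.
have P0 : 0 < P by rewrite sqrtr_gt0 divr_gt0// pi_gt0.
(* a lower bound for gaussian_hat 2 on [-1, 1] *)
pose g := P * expR (- h).
have g0 : 0 < g by rewrite mulr_gt0 ?expR_gt0.
exists ((2 + `|c|) `^ s * A^-1 * `|c| * g ^+ 2).
  by rewrite !mulr_gt0 ?invr_gt0 ?powR_gt0 ?expR_gt0//; lra.
move=> N N1 cN; have N0 : 0 < N by lra.
have k0 : 0 < 2 / N ^+ 4 by rewrite divr_gt0 ?exprn_gt0.
rewrite Xnorm_partial_x_gaborE//.
set t1 := beta * _.
pose m := (2 + `|c|) `^ s * N `^ s * A^-1 * (`|c| * N / 2 * (N ^+ 2 * g * g)).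
have -> : (2 + `|c|) `^ s * A^-1 * `|c| * g ^+ 2 * (N `^ s * N ^+ 2) =
    m * (2 * Num.sqrt (N ^- 2 * 1)).
  have Ni0 : 0 < N^-1 by rewrite invr_gt0.
  rewrite mulr1 -exprVn sqrtr_sqr (gtr0_norm Ni0) /m.
  by field; rewrite !gt_eqF.
have N20 : 0 < N ^- 2 by rewrite invr_gt0 exprn_gt0.
apply: (@Lnorm2_box_ge _ _ _ (c * N) t1) => //.
- apply: measurable_funM; first exact: measurable_bourgain_weight.
  apply: measurable_funM; last exact: measurable_gaussian_hat2.
  exact: measurableT_comp.
- by rewrite !mulr_ge0 ?powR_ge0 ?invr_ge0 ?(ltW A0) ?(ltW N0) ?(ltW P0) ?expR_ge0.
move=> q q1 q2.
rewrite gaussian_hat_scale// -(gaussian_hatN _ (_ * _)) -(gaussian_hatN 2 (t1 - _)).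
rewrite -(mulrN (N ^+ 2)) (opprB (c * N)) (opprB t1).
set y := N ^+ 2 * (q.1 - c * N); set z := q.2 - t1 in q2 *.
have y1 : `|y| <= 1.
  rewrite /y (normrM (N ^+ 2)) ger0_norm ?sqr_ge0// mulrC -ler_pdivlMr ?exprn_gt0//.
  by rewrite div1r.
have N2le : N ^- 2 <= 1 by rewrite invf_le1 ?exprn_gt0// exprn_ege1.
have cNE : `|c * N| = `|c| * N by rewrite normrM (gtr0_norm N0).
have gle x : `|x| <= 1 -> g <= gaussian_hat 2 x.
  move=> x1; rewrite ler_pM2l// ler_expR lerN2.
  rewrite ler_piMr ?(ltW h0)// -(real_normK (num_real x)).
  by rewrite exprn_ile1.
have W1 : (2 + `|c|) `^ s * N `^ s <= bracket q.1 `^ s.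
  rewrite -powRM ?(ltW N0)//.
  apply: ler_powR_npos => //; first exact: bracket_gt0.
  have := ler_normD (q.1 - c * N) (c * N); rewrite subrK cNE /bracket.
  by move=> ?; nra.
have W2 : A^-1 <= bracket (q.2 - beta * q.1 ^+ 3) `^ b.
  apply: powR_ge_norm; first exact: bracket_ge1.
  apply: le_trans (bracket_modulation_le beta c q.1 q.2 N1) _.
  rewrite -/y -/t1 -/z.
  have y2 : bracket y <= 2 by rewrite /bracket; lra.
  have z2 : bracket z <= 2 by rewrite /bracket; lra.
  have c1 : 0 <= curvature beta c by lra.
  have y3 : bracket y ^+ 3 <= 2 ^+ 3 by rewrite lerXn2r ?nnegrE ?bracket_ge0.
  apply: ler_pM; [|exact: bracket_ge0|by rewrite ler_wpM2l|by []].
  by rewrite mulr_ge0// exprn_ge0// bracket_ge0.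
have W3 : `|c| * N / 2 <= `|q.1|.
  have := ler_normD (c * N - q.1) q.1; rewrite subrK cNE distrC.
  by move=> ?; lra.
have W4 : N ^+ 2 * g * g <= N ^+ 2 * gaussian_hat 2 y * gaussian_hat 2 z.
  have gy := gle _ y1; have gz := gle _ q2.
  apply: ler_pM; [|exact: ltW|by rewrite ler_wpM2l ?sqr_ge0|by []].
  by apply: mulr_ge0; [exact: sqr_ge0|exact: ltW].
have Ai0 : 0 <= A^-1 by rewrite invr_ge0 ltW.
have Ng0 : 0 <= N ^+ 2 * g * g.
  by apply: mulr_ge0; [apply: mulr_ge0; [exact: sqr_ge0|]|]; exact: ltW.
have cN0 : 0 <= `|c| * N / 2 by lra.
have w0 : 0 <= (2 + `|c|) `^ s * N `^ s by rewrite mulr_ge0 ?powR_ge0.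
rewrite /m; apply: ler_pM; [exact: mulr_ge0|exact: mulr_ge0| |].
  exact: ler_pM.
exact: ler_pM.
Qed.

(** The norms would give K3 N^(s+2) <= C (K1 N^(s+1)) (K2 N^(s+1)) for all large
N, that is, a bound on N^(-s). *)
Lemma resonant_not_bilinear_estimate (b1 b2 b3 s c1 c2 beta1 beta2 beta3 : R) :
  s < 0 -> c1 != 0 -> c2 != 0 -> c1 + c2 != 0 ->
  beta1 * c1 ^+ 3 + beta2 * c2 ^+ 3 = beta3 * (c1 + c2) ^+ 3 ->
  ~ bilinear_estimate (Xnorm_ beta3 s b3) (Xnorm_ beta1 s b1) (Xnorm_ beta2 s b2).
Proof.
move=> s0 c10 c20 c30 res [C H].
have [K1 K10 H1] := Xnorm_gabor_le beta1 b1 (ltW s0) c10.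
have [K2 K20 H2] := Xnorm_gabor_le beta2 b2 (ltW s0) c20.
have [K3 K30 H3] := Xnorm_partial_x_gabor_ge beta3 b3 (ltW s0) c30.
pose L := `|C| * (K1 * K2).
have L0 : 0 <= L by rewrite !mulr_ge0.
have c3p : 0 < `|c1 + c2| by rewrite normr_gt0.
have key N : 1 <= N -> 2 <= `|c1 + c2| * N -> K3 * N `^ (- s) <= L.
  move=> N1 cN; have N0 : 0 < N by lra.
  have k0 : 0 < 1 / N ^+ 4 by rewrite divr_gt0 ?exprn_gt0.
  have := H _ _ (schwartz_gabor (c1 * N) (beta1 * (c1 * N) ^+ 3) k0 ltr01)
                (schwartz_gabor (c2 * N) (beta2 * (c2 * N) ^+ 3) k0 ltr01).
  under eq_fun do rewrite gaborM.
  (* the product is the packet of Xnorm_partial_x_gabor_ge, by resonance *)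
  have -> : 1 / N ^+ 4 + 1 / N ^+ 4 = 2 / N ^+ 4 by lra.
  have -> : c1 * N + c2 * N = (c1 + c2) * N by ring.
  have -> : beta1 * (c1 * N) ^+ 3 + beta2 * (c2 * N) ^+ 3 =
      beta3 * ((c1 + c2) * N) ^+ 3.
    transitivity ((beta1 * c1 ^+ 3 + beta2 * c2 ^+ 3) * N ^+ 3); first by ring.
    by rewrite res; ring.
  move=> /(le_trans (H3 N N1 cN)) h3.
  set V1 := Xnorm_ beta1 s b1 _ in h3; set V2 := Xnorm_ beta2 s b2 _ in h3.
  have V10 : (0 <= V1)%E by exact: Lnorm_ge0.
  have V20 : (0 <= V2)%E by exact: Lnorm_ge0.
  have h12 : (V1 * V2 <= (K1 * (N `^ s * N) * (K2 * (N `^ s * N)))%:E)%E.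
    by rewrite EFinM; apply: lee_pmul => //; [exact: H1|exact: H2].
  have : (C%:E * (V1 * V2) <=
      `|C|%:E * (K1 * (N `^ s * N) * (K2 * (N `^ s * N)))%:E)%E.
    apply: (@le_trans _ _ (`|C|%:E * (V1 * V2))%E).
      by apply: lee_wpmul2r; rewrite ?mule_ge0// lee_fin ler_norm.
    by apply: lee_wpmul2l.
  move=> /(le_trans h3); rewrite -EFinM lee_fin => h4.
  have p0 : 0 < N `^ s * N ^+ 2 by rewrite mulr_gt0 ?powR_gt0 ?exprn_gt0.
  rewrite powRN ler_pdivrMr ?powR_gt0// -(ler_pM2r p0) (le_trans h4)//.
  by rewrite /L le_eqVlt; apply/orP; left; apply/eqP; ring.
(* T solves K3 T^(-s) = L + 1; the other terms of N meet the side conditions *)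
pose T := ((L + 1) / K3) `^ (- s)^-1.
pose N := 1 + 2 / `|c1 + c2| + T.
have T0 : 0 <= T by exact: powR_ge0.
have d0 : 0 <= 2 / `|c1 + c2| by rewrite divr_ge0.
have : K3 * N `^ (- s) <= L.
  apply: key; first by rewrite /N; lra.
  by rewrite mulrC -ler_pdivrMr// /N; lra.
apply/negP; rewrite -ltNge (@lt_le_trans _ _ (K3 * T `^ (- s)))//.
  have s1 : - s != 0 by rewrite oppr_eq0 lt_eqF.
  rewrite -powRrM mulVf// powRr1 ?divr_ge0 ?addr_ge0 ?(ltW K30)//.
  by rewrite mulrCA divff ?gt_eqF// mulr1 ltrDl.
rewrite (ler_pM2l K30) ge0_ler_powR ?nnegrE ?oppr_ge0 ?(ltW s0)//; rewrite /N; lra.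
Qed.

Lemma quadratic_root (p q r : R) : p != 0 -> 0 <= q ^+ 2 - 4 * p * r ->
  exists x, p * x ^+ 2 + q * x + r = 0.
Proof.
move=> p0 D0; exists ((- q + Num.sqrt (q ^+ 2 - 4 * p * r)) / (2 * p)).
have := sqr_sqrtr D0; set w := Num.sqrt _ => w2.
have -> : p * ((- q + w) / (2 * p)) ^+ 2 + q * ((- q + w) / (2 * p)) + r =
  (w ^+ 2 - (q ^+ 2 - 4 * p * r)) / (4 * p) by field.
by rewrite w2 subrr mul0r.
Qed.

End gabor_norms.

Theorem proposition5p4 (R : realType) (alpha s : R) (halpha0 : 0 < alpha)
    (halpha1 : alpha < 1) (hs : s < 0) (b : R) :
  ~ bilinear_estimate (Xnorm s (b - 1)) (Xnorm_ alpha s b) (Xnorm_ alpha s b)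
  /\ ~ bilinear_estimate (Xnorm_ alpha s (b - 1)) (Xnorm s b) (Xnorm_ alpha s b).
Proof.
split.
(* alpha (r^3 + 1) - (r + 1)^3 is r + 1 times this quadratic, up to sign *)
- have [||r Hr] := @quadratic_root R (1 - alpha) (2 + alpha) (1 - alpha).
  + by rewrite subr_eq0 gt_eqF.
  + by nra.
  apply: (@resonant_not_bilinear_estimate _ b b (b - 1) s r 1 alpha alpha 1) => //.
  + by apply/eqP => r0; rewrite r0 in Hr; lra.
  + by apply/eqP => r0; have r1 : r = -1 by [lra]; rewrite r1 in Hr; lra.
  + apply/eqP; rewrite -subr_eq0; apply/eqP.
    transitivity (- (r + 1) *
      ((1 - alpha) * r ^+ 2 + (2 + alpha) * r + (1 - alpha))); first by ring.
    by rewrite Hr mulr0.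
(* 1 + alpha r^3 = alpha (1 + r)^3 loses its cubic terms *)
- have [||r Hr] := @quadratic_root R (3 * alpha) (3 * alpha) (alpha - 1).
  + by rewrite mulf_neq0// gt_eqF.
  + by nra.
  apply: (@resonant_not_bilinear_estimate _ b b (b - 1) s 1 r 1 alpha alpha) => //.
  + by apply/eqP => r0; rewrite r0 in Hr; lra.
  + by apply/eqP => r0; have r1 : r = -1 by [lra]; rewrite r1 in Hr; lra.
  + apply/eqP; rewrite -subr_eq0; apply/eqP.
    transitivity (- (3 * alpha * r ^+ 2 + 3 * alpha * r + (alpha - 1))); first by ring.
    by rewrite Hr oppr0.
Qed.
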